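(* Let $L\subseteq\mathbb R^n$ be a convex body and $K\in\mathscr K(\mathbb R^n)$ such that $K\subseteq L$. Let $\mu=(\mu_j)_{j\ge1}$ be an admissible weight satisfying $\mu_j\ge j$ for $j\ge1$. Let $M_0>b_0>0$. Assume that $(\mu,M_0,a_K,b_0)$ is admissible and let $\mathbf N=\mathbf N(\mu,M_0,a_K,b_0)$. Let $f:L\to\mathbb R$ be a $(\mu^{|\mathbf N},M_0)$-smooth function satisfying $\|f\|_K\ge b_0$. Let $E\subseteq K$ be a Lebesgue measurable subset with $|E|>0$. Then, for all $0<q<p\le\infty$ (with $q/p=1/p=0$ if $p=\infty$), $$\|f\|^\sharp_{L^p(K)}\le\Big(\mathbf C_{\mathbf N}\Big(\frac{|K|}{\nu_K|E|}\Big)^{\mathbf N}\Big)^{1-\frac qp}(q\mathbf N+1)^{\frac1q-\frac1p}\big(\|f\|^\sharp_{L^q(K)}\big)^{\frac qp}\big(\|f\|^\sharp_{L^q(E)}\big)^{1-\frac qp}.$$ In particular, $$\|f\|^\sharp_{L^p(K)}\le\Big(\frac{\mathbf C_{\mathbf N}}{\nu_K^{\mathbf N}}\Big)^{1-\frac qp}(q\mathbf N+1)^{\frac1q-\frac1p}\|f\|^\sharp_{L^q(K)}$$ and $$\|f\|^\sharp_{L^p(K)}\le\mathbf C_{\mathbf N}\Big(\frac{|K|}{\nu_K|E|}\Big)^{\mathbf N}(q\mathbf N+1)^{\frac1q}\|f\|^\sharp_{L^q(E)}.$$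
   Context: $|E|$ denotes Lebesgue measure. A convex body is a compact convex set with nonempty interior. Normalized norms: $\|f\|^\sharp_{L^p(E)}:=\big(\frac1{|E|}\int_E|f(x)|^p\,dx\big)^{1/p}$ for $0<p<\infty$ and $\|f\|^\sharp_{L^\infty(E)}:=\operatorname{ess\,sup}_E|f|$, for measurable $E$ with $0<|E|<\infty$. Weights and smoothness. An admissible weight is a sequence $\mu=(\mu_j)_{j\ge1}$ of reals with $0<\mu_1\le\mu_2\le\cdots$. Given $M_0>0$ put $M_j=M_0\mu_1\cdots\mu_j$, $j\ge1$. For $N\in\mathbb N_{\ge1}\cup\{\infty\}$ and nonempty compact $L\subseteq\mathbb R^n$, a map $f=(f_1,\dots,f_m):L\to\mathbb R^m$ is $(\mu^{|N},M_0)$-smooth if it is of class $C^N$ in some open neighborhood of $L$ and $\sup_{x\in L}\sum_{i=1}^m\sum_{|\alpha|=j}\frac{j!}{\alpha!}|\partial^\alpha f_i(x)|\le M_j$ for all integers $0\le j<N+1$. Also $\|f\|_E:=\sup_{x\in E}\sum_{i=1}^m|f_i(x)|$. Degree. For $A,a,b>0$ let $j_0$ be the smallest nonnegative integer $\ge\log(A/b)$. The tuple $(\mu,A,a,b)$ is admissible if $\sum_{j=j_0+1}^\infty 1/\mu_j>a\,e$; then $\mathbf N(\mu,A,a,b):=2\sup\{k\in\mathbb N:\sum_{j=j_0+1}^k\frac1{a\mu_j}<e\}$ (empty sums are $0$). The constant $\mathbf C_{\mathbf N}$. Fix an increasing continuous, (piecewise) $C^1$ function $\tilde\mu:[1,\infty)\to(0,\infty)$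 with $\tilde\mu(j)=\mu_j$ for integers $j\ge1$ (left derivatives are used at points of nondifferentiability), put $\gamma_{\tilde\mu}(k):=\sup_{1\le s\le k}\frac{s\tilde\mu'(s)}{\tilde\mu(s)}$, and $\mathbf C_{\mathbf N}:=(4e^{4+\gamma_{\tilde\mu}(\mathbf N)})^{\mathbf N}$. Admissible sets. A family $(K_w,a_w,\Upsilon_w)_{w\in W}$, where $W$ is any set, $K_w\subseteq[0,1]^n$ is compact, $a_w\in K_w$, and $\Upsilon_w:[0,\infty)^n\to\mathbb R^n$ is a map, is an admissible collection of degree $d\in\mathbb N_{\ge1}$ if there are constants $\delta_1,\delta_2,\delta_3>0$, $q\in\mathbb N_{\ge1}$ and polynomial maps $R_w:\mathbb R^n\to\mathbb R^n$ of degree at most $d$ such that for all $w\in W$: (1) $K_w$ is star-shaped with respect to $a_w$ and $|K_w|\ge\delta_1$; (2) $\Upsilon_w(x_1,\dots,x_n)=R_w(x_1^{1/q},\dots,x_n^{1/q})$; (3) $\delta_2\le\sum_\kappa|c_{w,\kappa}|\le\delta_3$, where $c_{w,\kappa}$ are the coefficients of the polynomial $\operatorname{Jac}(R_w)$ (the Jacobian determinant); (4) writing $a_w=(a_{w,1},\dots,a_{w,n})$, $a_{w,i}=0$ whenever $\Upsilon_w$ is not a polynomial map with respect to the variable $x_i$. A nonempty compact set $K\subseteq\mathbb R^n$ is admissible (of degree $d$) if there is an admissible collection (of degree $d$) $(K_w,a_w,\Upsilon_w)_{w\in K}$ indexed by $K$ with $\Upsilon_w(a_w)=w$ for each $w\in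 K$ and $K=\bigcup_{w\in K}\Upsilon_w(K_w)$. $\mathscr K(\mathbb R^n)$ is the family of all admissible sets. For each $K\in\mathscr K(\mathbb R^n)$ such a collection and its degree $d$ are fixed ($d=1$ if $K$ is a convex body), and $$a_K:=4\,\tfrac{(d+1)^{d+1}}{(d-1)^{d-1}}\max\{\operatorname{diam}(K),1\}\ \text{ if }d\ge2,\qquad a_K:=\operatorname{diam}(K)\ \text{ if }d=1.$$ The constant $\nu_K$. For $K\in\mathscr K(\mathbb R^n)$, $\nu_K\in(0,1]$ denotes a fixed constant depending only on $K$ (with $\nu_K=1/n$ if $K$ is a convex body) for which the paper's Remez inequality holds: for every convex body $L\supseteq K$, every admissible weight $\mu$ with $\mu_j\ge j$, all $M_0>b_0>0$ and $m\ge1$ with $(\mu,mM_0,a_K,b_0)$ admissible and $\mathbf N'=\mathbf N(\mu,mM_0,a_K,b_0)$, every $(\mu^{|\mathbf N'},M_0)$-smooth $f:L\to\mathbb R^m$ with $\|f\|_K\ge b_0$, and every measurable $E\subseteq K$ with $|E|>0$, $\|f\|_K\le\mathbf C_{\mathbf N'}\big(\frac{m|K|^{\nu_K}}{|K|^{\nu_K}-(|K|-|E|)^{\nu_K}}\big)^{\mathbf N'}\|f\|_E$. (Such a constant exists for every $K\in\mathscr K(\mathbb R^n)$.) *)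

(* Defs.v *)
From HB Require Import structures.
From mathcomp Require Import all_boot all_order all_algebra.
(* The notations of mpoly clash with those of mathcomp-analysis. *)
From mathcomp Require Import -(notations) mpoly.
From mathcomp Require Import all_classical all_reals all_analysis.

Set Implicit Arguments.
Unset Strict Implicit.
Unset Printing Implicit Defensive.

Import Order.TTheory GRing.Theory Num.Theory.
Import numFieldNormedType.Exports.

Local Open Scope classical_set_scope.
Local Open Scope ring_scope.

(* Euclidean space of dimension n >= 1 is written 'rV[R]_n'.+1.  Its topology
   is the library's (sup-norm) one; Euclidean lengths are spelled out below. *)

Section lebesgue_measure_Rn.
Variables (R : realType) (n : nat).
Implicit Types (a b : 'rV[R]_n.+1) (A : set 'rV[R]_n.+1).

Definition box a b : set 'rV[R]_n.+1 :=
  [set x | forall i, a 0 i <= x 0 i <= b 0 i].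

(* The box is empty, and the product 0, as soon as b 0 i < a 0 i for some i. *)
Definition box_volume a b : R := \prod_i Num.max 0 (b 0 i - a 0 i).

Lemma box_volume_ge0 a b : 0 <= box_volume a b.
Proof. by apply: prodr_ge0 => i _; rewrite le_max lexx. Qed.

Definition box_cover A : set (nat -> 'rV[R]_n.+1 * 'rV[R]_n.+1) :=
  [set c | A `<=` \bigcup_k box (c k).1 (c k).2].

Local Open Scope ereal_scope.

Definition lebesgue_outer A : \bar R :=
  ereal_inf [set \sum_(k <oo) (box_volume (c k).1 (c k).2)%:E
            | c in box_cover A].

Lemma lebesgue_outer_ge0 A : 0 <= lebesgue_outer A.
Proof.
apply: le_ereal_inf_tmp => x [c _ <-{x}].
by apply: nneseries_ge0 => k _ _; rewrite lee_fin box_volume_ge0.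
Qed.

Lemma lebesgue_outer0 : lebesgue_outer set0 = 0.
Proof.
apply/eqP; rewrite eq_le lebesgue_outer_ge0 andbT.
apply: ereal_inf_lbound; exists (fun=> (0%R, 0%R)) => //.
apply: eseries0 => k _ _; rewrite /box_volume (bigD1 ord0)//=.
by rewrite mxE subrr maxxx mul0r.
Qed.

Lemma le_lebesgue_outer :
  {homo lebesgue_outer : A B / A `<=` B >-> A <= B}.
Proof.
move=> A B AB; apply/ereal_inf_le_tmp => x [c Bc <-{x}].
by exists c => //; exact: subset_trans AB Bc.
Qed.

Lemma lebesgue_outer_sigma_subadditive : sigma_subadditive lebesgue_outer.
Proof.
move=> A; have [[i ioo]|] := pselect (exists i, lebesgue_outer (A i) = +oo).
  rewrite (eseries_pinfty _ _ ioo) ?leey// => k _.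
  by rewrite -ltNye (lt_le_trans _ (lebesgue_outer_ge0 _)).
rewrite -forallNE => Aoo.
suff add2e (e : {posnum R}) :
    lebesgue_outer (\bigcup_n A n) <=
    \sum_(i <oo) lebesgue_outer (A i) + e%:num%:E.
  by apply/lee_addgt0Pr => _/posnumP[].
rewrite (le_trans _ (epsilon_trick _ _ _))//; last first.
  by move=> k; exact: lebesgue_outer_ge0.
pose v (c : 'rV[R]_n.+1 * 'rV[R]_n.+1) : \bar R := (box_volume c.1 c.2)%:E.
have v0 c : 0 <= v c by rewrite lee_fin box_volume_ge0.
pose P k c := box_cover (A k) c /\
  \sum_(j <oo) v (c j) <=
  lebesgue_outer (A k) + (e%:num / (2 ^ k.+1)%:R)%:E.
have [G PG] : {G : nat -> nat -> 'rV[R]_n.+1 * 'rV[R]_n.+1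
                 & forall k, P k (G k)}.
  apply: (@choice _ _ P) => k; rewrite /P /lebesgue_outer.
  set S := (X in ereal_inf X); move infS : (ereal_inf S) => iS.
  case: iS infS => [r Sr|Soo|Soo].
  - have en1 : (0 < e%:num / (2 ^ k.+1)%:R)%R by [].
    have /(lb_ereal_inf_adherent en1) : ereal_inf S \is a fin_num by rewrite Sr.
    move=> [x [c Ac muBx] xS].
    by exists c; split => //; rewrite /v muBx -Sr; exact/ltW.
  - by have := Aoo k; rewrite /lebesgue_outer Soo.
  - suff : lbound S 0 by move/le_ereal_inf_tmp; rewrite Soo.
    by move=> /= _ [c Ac <-]; apply: nneseries_ge0 => ? _ _; exact: (v0 (c _)).
have vG0 x : 0 <= (v \o uncurry G) x by exact: v0.
apply: (@le_trans _ _ (\esum_(i in setT) (v \o uncurry G) i)).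
  rewrite /lebesgue_outer; apply: ereal_inf_lbound => /=.
  have /card_esym/ppcard_eqP[f] := card_nat2.
  exists (uncurry G \o f).
    move=> t [i _ /((PG i).1) [j _ tij]].
    by exists (f^-1%FUN (i, j)) => //=; rewrite invK ?inE.
  rewrite -(esum_pred_image (v \o uncurry G) _ xpredT) ?[fun=> _]set_true//.
  by rewrite image_eq.
rewrite (_ : esum _ _ = \sum_(i <oo) \sum_(j <oo) v (G i j)); last first.
  pose J : nat -> set (nat * nat) := fun i => [set (i, j) | j in setT].
  rewrite (_ : setT = \bigcup_k J k); last first.
    by rewrite predeqE => -[a b]; split => // _; exists a => //; exists b.
  rewrite esum_bigcupT /=; last 2 first.
    - apply/trivIsetP => i j _ _ ij.
      rewrite predeqE => -[k m] /=; split => //= -[] [_] _ [<-{k} _].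
      by move=> [m' _] [] /esym/eqP; rewrite (negbTE ij).
    - by move=> ?; exact: v0.
  rewrite -(image_id [set: nat]) -fun_true esum_pred_image//; last first.
    by move=> k _; exact: esum_ge0.
  apply: eq_eseriesr => /= j _.
  rewrite -(esum_pred_image (v \o uncurry G) (pair j) predT)//=; last first.
    by move=> ? ? _ _; exact: (@can_inj _ _ _ snd).
  by congr esum; rewrite predeqE => -[a b]; split; move=> [i _ <-]; exists i.
apply: lee_nneseries => [k _ _|k _]; first by apply: nneseries_ge0 => *.
exact: (PG k).2.
Qed.

HB.instance Definition _ := isOuterMeasure.Build R 'rV[R]_n.+1 lebesgue_outer
  lebesgue_outer0 lebesgue_outer_ge0 le_lebesgue_outer
  lebesgue_outer_sigma_subadditive.

Definition lebesgue_space := caratheodory_type lebesgue_outer.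

HB.instance Definition _ := Measurable.on lebesgue_space.

Definition lebesgue : set lebesgue_space -> \bar R := lebesgue_outer.

HB.instance Definition _ := isMeasure.Build _ lebesgue_space R lebesgue
  (@caratheodory_measure0 _ _ lebesgue_outer)
  (@caratheodory_measure_ge0 _ _ lebesgue_outer)
  (@caratheodory_measure_sigma_additive _ _ lebesgue_outer).

Definition lebesgue_measurable A : Prop :=
  measurable (A : set lebesgue_space).

Definition volume A : R := fine (lebesgue A).

(* The normalized norm of L^p(E), for 0 < p <= +oo; p = -oo is junk. *)
Definition normalized_norm (p : \bar R) (E : set 'rV[R]_n.+1)
    (f : 'rV[R]_n.+1 -> R) : \bar R :=
  match p with
  | r%:E =>
      (((volume E)^-1)%:E * \int[lebesgue]_(x in E) (`|f x| `^ r)%:E) `^ r^-1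
  | +oo => ereal_inf
      [set y | \forall x \ae lebesgue, E x -> (`|f x|)%:E <= y]
  | -oo => 0
  end.

End lebesgue_measure_Rn.

(* 1/p, with 1/oo = 0 *)
Definition inv_exponent (R : realType) (p : \bar R) : R :=
  if p is r%:E then r^-1 else 0.

Section geometry.
Variables (R : realType) (n : nat).
Implicit Types (A K : set 'rV[R]_n.+1).

Definition convex_body A : Prop :=
  [/\ compact A, convex_set A & A° !=set0].

Definition euclidean_dist (x y : 'rV[R]_n.+1) : R :=
  Num.sqrt (\sum_i (x 0 i - y 0 i) ^+ 2).

Definition diam A : R :=
  sup [set euclidean_dist z.1 z.2 | z in A `*` A].

Definition star_shaped A (a : 'rV[R]_n.+1) : Prop :=
  forall x (t : R), A x -> 0 <= t <= 1 -> A ((1 - t) *: a + t *: x).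

End geometry.

Section smoothness.
Variable R : realType.
Implicit Type mu : nat -> R.

(* A weight (mu_j)_{j >= 1} is a sequence whose value at 0 is irrelevant. *)
Definition admissible_weight mu : Prop :=
  0 < mu 1%N /\ forall j, (1 <= j)%N -> mu j <= mu j.+1.

Definition weight_bound mu (M0 : R) (j : nat) : R :=
  M0 * \prod_(1 <= i < j.+1) mu i.

Section partial_derivatives.
Variable n : nat.
Implicit Types (g : 'rV[R]_n.+1 -> R) (s : seq 'I_n.+1).

Definition partial (i : 'I_n.+1) g : 'rV[R]_n.+1 -> R :=
  fun x => 'D_(delta_mx 0 i) g x.

Definition iter_partial s g := foldr partial g s.

Definition class_C (N : nat) (U : set 'rV[R]_n.+1) g : Prop :=
  (forall s x, (size s <= N)%N -> U x -> {for x, continuous (iter_partial s g)})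
  /\ (forall s i x, (size s < N)%N -> U x ->
        derivable (iter_partial s g) x (delta_mx 0 i)).

(* The multi-indices of length j are the al : {ffun 'I_n.+1 -> 'I_j.+1} whose
   entries sum to j. *)
Definition multi_partial j (al : {ffun 'I_n.+1 -> 'I_j.+1}) g :=
  iter_partial (flatten [seq nseq (al i) i | i <- enum 'I_n.+1]) g.

Definition multi_fact j (al : {ffun 'I_n.+1 -> 'I_j.+1}) : nat :=
  (\prod_i (al i)`!)%N.

End partial_derivatives.

(* A map on L is represented by (any extension to) a total function; only
   finite orders N are needed. *)
Definition smooth n m mu (N : nat) (M0 : R) (L : set 'rV[R]_n.+1)
    (f : 'rV[R]_n.+1 -> 'rV[R]_m) : Prop :=
  (exists U : set 'rV[R]_n.+1,
     [/\ open U, L `<=` U & forall i, class_C N U (fun x => f x 0 i)]) /\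
  (forall j x, (j <= N)%N -> L x ->
     \sum_(i < m)
       \sum_(al : {ffun 'I_n.+1 -> 'I_j.+1} | (\sum_k al k == j)%N)
         (j`!%:R / (multi_fact al)%:R) *
           `|multi_partial al (fun y => f y 0 i) x|
     <= weight_bound mu M0 j).

Definition sup_norm n m (E : set 'rV[R]_n.+1) (f : 'rV[R]_n.+1 -> 'rV[R]_m) : R :=
  sup [set \sum_i `|f x 0 i| | x in E].

Definition scalar_map n (f : 'rV[R]_n.+1 -> R) : 'rV[R]_n.+1 -> 'rV[R]_1 :=
  fun x => const_mx (f x).

Definition j0 (A b : R) : nat := absz (Num.max 0 (Num.ceil (ln (A / b)))).

Definition admissible_tuple mu (A a b : R) : Prop :=
  [/\ 0 < A, 0 < a, 0 < b &
      ((a * expR 1)%:E < \sum_((j0 A b).+1 <= j <oo) ((mu j)^-1)%:E)%E].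

Definition degree_set mu (A a b : R) : set nat :=
  [set k | \sum_((j0 A b).+1 <= j < k.+1) (a * mu j)^-1 < expR 1].

(* When the tuple is admissible, degree_set is finite, so that its real
   supremum is a natural number. *)
Definition degreeN mu (A a b : R) : nat :=
  (2 * Num.truncn (sup [set (k%:R : R) | k in degree_set mu A a b]))%N.

Definition piecewise_C1 (h : R -> R) : Prop :=
  exists t : nat -> R,
    [/\ t 0%N = 1, forall k, t k < t k.+1, t @ \oo --> +oo &
      forall k, exists g : R -> R,
        {within `[t k, t k.+1], continuous g} /\
        forall s, t k < s < t k.+1 -> is_derive s 1 h (g s)].

Definition weight_interpolation mu (h : R -> R) : Prop :=
  [/\ {in `[1, +oo[ &, {homo h : s t / s <= t}},
      {within `[1, +oo[, continuous h},
      piecewise_C1 h,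
      forall s, 1 <= s -> 0 < h s &
      forall j : nat, (1 <= j)%N -> h j%:R = mu j].

(* The left derivative agrees with the derivative wherever the latter exists;
   at the endpoint 1 of the domain only a right derivative makes sense. *)
Definition one_sided_derivative (h : R -> R) (s : R) : R :=
  let quotient e := e^-1 * (h (s + e) - h s) in
  if s == 1 then lim (quotient @ 0^'+) else lim (quotient @ 0^'-).

Definition gamma_growth (h : R -> R) (k : R) : R :=
  sup [set s * one_sided_derivative h s / h s | s in `[1, k]].

Definition constC (h : R -> R) (N : nat) : R :=
  (4 * expR (4 + gamma_growth h N%:R)) ^+ N.

End smoothness.

Section admissible_sets.
Variables (R : realType) (n : nat).

Definition unit_cube : set 'rV[R]_n.+1 := [set x | forall i, 0 <= x 0 i <= 1].

Definition orthant : set 'rV[R]_n.+1 := [set x | forall i, 0 <= x 0 i].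

Definition poly_map := 'I_n.+1 -> mpoly n.+1 R.

Definition eval_map (P : poly_map) (x : 'rV[R]_n.+1) : 'rV[R]_n.+1 :=
  \row_i meval (fun j => x 0 j) (P i).

(* msize is one more than the total degree (and 0 for the zero polynomial). *)
Definition degree_le (d : nat) (P : poly_map) : Prop :=
  forall i, (msize (P i) <= d.+1)%N.

Definition poly_jacobian (P : poly_map) : mpoly n.+1 R :=
  \det (\matrix_(i, j) mderiv j (P i)).

Definition coef_norm (p : mpoly n.+1 R) : R :=
  \sum_(k <- msupp p) `|mcoeff k p|.

Definition root_map (q : nat) (x : 'rV[R]_n.+1) : 'rV[R]_n.+1 :=
  \row_i (x 0 i `^ q%:R^-1).

Definition update (x : 'rV[R]_n.+1) (i : 'I_n.+1) (t : R) : 'rV[R]_n.+1 :=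
  \row_j (if j == i then t else x 0 j).

Definition polynomial_wrt (F : 'rV[R]_n.+1 -> 'rV[R]_n.+1) (i : 'I_n.+1) : Prop :=
  forall x, orthant x -> forall j, exists p : {poly R},
    forall t, 0 <= t -> F (update x i t) 0 j = p.[t].

(* The maps Ups w matter only on the orthant [0, oo)^n. *)
Definition admissible_collection (T : Type) (W : set T) (d : nat)
    (K_ : T -> set 'rV[R]_n.+1) (a_ : T -> 'rV[R]_n.+1)
    (Ups : T -> 'rV[R]_n.+1 -> 'rV[R]_n.+1) : Prop :=
  [/\ (1 <= d)%N,
      forall w, W w -> [/\ K_ w `<=` unit_cube, compact (K_ w) & K_ w (a_ w)] &
      exists (delta1 delta2 delta3 : R) (q : nat) (P : T -> poly_map),
        [/\ 0 < delta1, 0 < delta2, 0 < delta3, (1 <= q)%N &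
          forall w, W w ->
            [/\ degree_le d (P w),
                star_shaped (K_ w) (a_ w) /\ (delta1%:E <= lebesgue (K_ w))%E,
                forall x, orthant x -> Ups w x = eval_map (P w) (root_map q x),
                delta2 <= coef_norm (poly_jacobian (P w)) <= delta3 &
                forall i, ~ polynomial_wrt (Ups w) i -> a_ w 0 i = 0]]].

Definition admissible_set (d : nat) (K : set 'rV[R]_n.+1) : Prop :=
  [/\ K !=set0, compact K &
      exists (K_ : 'rV[R]_n.+1 -> set 'rV[R]_n.+1)
             (a_ : 'rV[R]_n.+1 -> 'rV[R]_n.+1)
             (Ups : 'rV[R]_n.+1 -> 'rV[R]_n.+1 -> 'rV[R]_n.+1),
        [/\ admissible_collection K d K_ a_ Ups,
            forall w, K w -> Ups w (a_ w) = w &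
            K = \bigcup_(w in K) (Ups w @` K_ w)]].

(* d is the degree of the collection chosen once and for all for K. *)
Definition fixed_degree (d : nat) (K : set 'rV[R]_n.+1) : Prop :=
  admissible_set d K /\ (convex_body K -> d = 1%N).

Definition a_const (d : nat) (K : set 'rV[R]_n.+1) : R :=
  if (2 <= d)%N then
    4 * ((d.+1 ^ d.+1)%:R / (d.-1 ^ d.-1)%:R) * Num.max (diam K) 1
  else diam K.

(* mut chooses, for each admissible weight, the interpolating function from
   which the constants C_N are computed. *)
Definition remez_constant (mut : (nat -> R) -> R -> R) (d : nat)
    (K : set 'rV[R]_n.+1) (nu : R) : Prop :=
  [/\ 0 < nu <= 1,
      convex_body K -> nu = n.+1%:R^-1 &
      forall (L : set 'rV[R]_n.+1) (mu : nat -> R) (M0 b0 : R) (m : nat)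
             (f : 'rV[R]_n.+1 -> 'rV[R]_m) (E : set 'rV[R]_n.+1),
        convex_body L -> K `<=` L ->
        admissible_weight mu -> (forall j, (1 <= j)%N -> j%:R <= mu j) ->
        0 < b0 -> b0 < M0 -> (1 <= m)%N ->
        admissible_tuple mu (m%:R * M0) (a_const d K) b0 ->
        let N := degreeN mu (m%:R * M0) (a_const d K) b0 in
        smooth mu N M0 L f -> b0 <= sup_norm K f ->
        lebesgue_measurable E -> E `<=` K -> (0 < lebesgue E)%E ->
        sup_norm K f <=
          constC (mut mu) N *
          (m%:R * volume K `^ nu /
             (volume K `^ nu - (volume K - volume E) `^ nu)) ^+ N *
          sup_norm E f].

End admissible_sets.

(* Main.v *)
(* Since 1 - (1 - t)^nu >= nu t, the Remez inequality gives
   M := ||f||_K <= C (|K| / (nu |A|))^N ||f||_A for all measurable A of positive measure.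
   Applied to the sublevel sets A of |f| in E, it says that these are no larger than
   those of lam u^N for u uniform on [0, 1], where lam = M / (C (|K| / (nu |E|))^N);
   hence the mean of |f|^q on E is at least lam^q / (q N + 1), which bounds M by the
   normalized L^q norm on E. The three estimates follow from
   ||f||_p <= M^(1 - q/p) ||f||_q^(q/p) on K, by bounding M with E or with E = K. *)
Require Import Defs.
From mathcomp Require Import all_boot all_order all_algebra.
From mathcomp Require Import all_classical all_reals all_analysis.
From mathcomp Require Import measurable_realfun ring lra.

Set Implicit Arguments.
Unset Strict Implicit.
Unset Printing Implicit Defensive.

Import Order.TTheory GRing.Theory Num.Theory.
Import numFieldNormedType.Exports.

Local Open Scope classical_set_scope.
Local Open Scope ring_scope.

(** * Bernoulli inequalities and a Riemann sum for real powers *)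

Lemma bernoulli_powR (R : realType) (r x : R) : 1 <= r -> 0 <= x ->
  1 + r * (x - 1) <= x `^ r.
Proof.
rewrite le_eqVlt => /predU1P[<- x0|r1 x0]; first by rewrite powRr1//; lra.
have r0 : 0 < r by lra.
have ri1 : 0 < 1 - r^-1 by rewrite subr_gt0 invf_lt1.
(* Young's inequality for the product of [x] and [1], with conjugate exponents [r] and (1 -
   1/r)^-1. *)
have := @conjugate_powR _ x 1 r (1 - r^-1)^-1 x0 ler01 r0.
rewrite invr_gt0 invrK powR1 => /(_ ri1); rewrite addrCA subrr addr0 => /(_ erefl).
rewrite mulr1 mul1r -(ler_pM2l r0) mulrDr mulrBr mulfV ?gt_eqF//.
by rewrite [r * (_ / r)]mulrC mulfVK ?gt_eqF//; lra.
Qed.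

(** This is Bernoulli's inequality with exponent 1/nu at the point (1 - t)^nu. *)
Lemma powR_compl_le (R : realType) (nu t : R) : 0 < nu <= 1 -> 0 <= t <= 1 ->
  (1 - t) `^ nu <= 1 - nu * t.
Proof.
move=> /andP[nu0 nu1] /andP[t0 t1].
have := @bernoulli_powR _ nu^-1 ((1 - t) `^ nu).
rewrite invf_ge1// => /(_ nu1 (powR_ge0 _ _)).
rewrite -powRrM mulfV ?gt_eqF// powRr1 ?subr_ge0// -(ler_pM2l nu0).
rewrite mulrDr mulrA mulfV ?gt_eqF// !mul1r; lra.
Qed.

(* [sum (phi i - phi (i - 1)) (1 - i / k)] for [phi i = (i / k)^s] is a lower Riemann sum
   of [int_0^1 u^s du] after summation by parts. *)
Lemma powR_abel_sum_ge (R : realType) (s : R) (k : nat) : 0 < s -> (0 < k)%N ->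
  (s + 1)^-1 - k%:R^-1 <=
  \sum_(0 <= i < k) ((i.+1%:R / k%:R) `^ s - (i%:R / k%:R) `^ s) *
    (1 - i.+1%:R / k%:R).
Proof.
move=> s0 k0; have kR0 : 0 < k%:R :> R by rewrite ltr0n.
have kn0 : k%:R != 0 :> R by rewrite gt_eqF.
pose x i : R := i%:R / k%:R.
have x0 i : 0 <= x i by rewrite divr_ge0// ?ler0n.
have xS i : x i.+1 = x i + k%:R^-1 by rewrite /x -natr1 mulrDl mul1r.
(* Telescoping [G] yields the left-hand side. Its terms come from the summation by parts, the
   primitive of u^s, and the error of the Riemann sum. *)
pose G i : R := x i `^ s * (1 - x i) + x i `^ (s + 1) / (s + 1) - x i `^ s / k%:R.
have G0 : G 0%N = 0.
  by rewrite /G /x mul0r !powR0 ?mul0r ?subr0 ?add0r ?mul0r ?gt_eqF// addr_gt0.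
have -> : (s + 1)^-1 - k%:R^-1 = \sum_(0 <= i < k) (G i.+1 - G i).
  by rewrite telescope_sumr// G0 subr0 /G /x mulfV// !powR1 subrr mulr0 add0r !mul1r.
apply: ler_sum => i _; rewrite -/(x i.+1) -/(x i).
have xp : 0 < x i.+1 by rewrite divr_gt0// ltr0n.
(* Convexity of u^(s+1): the tangent at [x i.+1] lies below the graph, which is Bernoulli at the
   ratio of [x i] to [x i.+1]. *)
have step : x i.+1 `^ (s + 1) - x i `^ (s + 1) <= (s + 1) * (x i.+1 `^ s / k%:R).
  have [s1 d1] : 1 <= s + 1 /\ 0 <= x i / x i.+1 by split; [lra|rewrite divr_ge0].
  have := bernoulli_powR s1 d1.
  rewrite -(ler_pM2r (powR_gt0 (s + 1) xp)) -powRM// mulfVK ?gt_eqF//.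
  have -> : x i.+1 `^ (s + 1) = x i.+1 `^ s * x i.+1.
    by rewrite powRD ?powRr1// (gt_eqF xp) implybT.
  have -> : x i / x i.+1 - 1 = - (k%:R^-1 / x i.+1).
    by rewrite -(addrK k%:R^-1 (x i)) -xS mulrBl mulfV ?gt_eqF// addrAC subrr add0r.
  rewrite mulrDl mul1r (_ : _ * _ * (_ * _) = - ((s + 1) * (x i.+1 `^ s / k%:R))).
    lra.
  by field; rewrite kn0 gt_eqF.
have sp : 0 < s + 1 by lra.
move: step; rewrite -ler_pdivrMl// /G => step.
set a := x i.+1 `^ s in step *; set b := x i `^ s in step *.
set c := x i.+1 `^ _ in step *; set e := x i `^ _ in step *.
rewrite -subr_ge0 (_ : _ - _ = a / k%:R - (s + 1)^-1 * (c - e)) ?subr_ge0//.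
by rewrite (_ : x i = x i.+1 - k%:R^-1); [field; rewrite kn0 gt_eqF|rewrite xS addrK].
Qed.

(** * Open sets are Lebesgue measurable *)

Section lebesgue_borel.
Variables (R : realType) (n : nat).
Implicit Types (a b : 'rV[R]_n.+1) (A : set 'rV[R]_n.+1).

(** The box is cut by the hyperplane x_i = c. Truncating the cut by min and max keeps the identity
    true when the hyperplane misses the box, one piece then having volume 0. *)
Lemma box_volume_split a b (i : 'I_n.+1) (c : R) :
  box_volume a b = box_volume a (update b i (Num.min (b 0 i) c)) +
                   box_volume (update a i (Num.max (a 0 i) c)) b.
Proof.
have volD (a' b' : 'rV[R]_n.+1) : box_volume a' b' = Num.max 0 (b' 0 i - a' 0 i) *
    \prod_(j | j != i) Num.max 0 (b' 0 j - a' 0 j).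
  by rewrite /box_volume (bigD1 i).
rewrite (volD a b) (volD a) (volD _ b) !mxE eqxx.
have -> : \prod_(j | j != i) Num.max 0 (update b i (Num.min (b 0 i) c) 0 j - a 0 j) =
    \prod_(j | j != i) Num.max 0 (b 0 j - a 0 j).
  by apply: eq_bigr => j /negbTE ji; rewrite !mxE ji.
have -> : \prod_(j | j != i) Num.max 0 (b 0 j - update a i (Num.max (a 0 i) c) 0 j) =
    \prod_(j | j != i) Num.max 0 (b 0 j - a 0 j).
  by apply: eq_bigr => j /negbTE ji; rewrite !mxE ji.
rewrite -mulrDl; congr (_ * _); set u := a 0 i; set v := b 0 i.
by case: (leP v c); case: (leP u c); case: (leP 0 (v - u)); case: (leP 0 (c - u));
  case: (leP 0 (v - c)); case: leP => //=; lra.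
Qed.

(** Carathéodory's criterion: cutting every box of a cover of [X] along the hyperplane gives covers
    of the two parts of [X] with the same total volume. *)
Lemma lebesgue_measurable_halfspace (i : 'I_n.+1) (c : R) :
  lebesgue_measurable [set x : 'rV[R]_n.+1 | x 0 i <= c].
Proof.
apply: le_caratheodory_measurable => X.
apply: le_ereal_inf_tmp => _ [k Xk <-].
pose kl (j : nat) := ((k j).1, update (k j).2 i (Num.min ((k j).2 0 i) c)).
pose kr (j : nat) := (update (k j).1 i (Num.max ((k j).1 0 i) c), (k j).2).
have -> : (\sum_(j <oo) (box_volume (k j).1 (k j).2)%:E =
    \sum_(j <oo) (box_volume (kl j).1 (kl j).2)%:E +
    \sum_(j <oo) (box_volume (kr j).1 (kr j).2)%:E)%E.
  rewrite -nneseriesD; last 2 first.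
  - by move=> *; rewrite lee_fin box_volume_ge0.
  - by move=> *; rewrite lee_fin box_volume_ge0.
  by apply: eq_eseriesr => j _; rewrite (box_volume_split _ _ i c).
apply: leeD; apply: ereal_inf_lbound; eexists => //.
  move=> x [/Xk[j _ xj] /= xc]; exists j => //= l; rewrite mxE.
  by case: eqP => [->|_]; [rewrite le_min xc andbT|]; exact: xj.
move=> x [/Xk[j _ xj] /= /negP]; rewrite -ltNge => xc; exists j => //= l; rewrite mxE.
by case: eqP => [->|_]; [rewrite ge_max (ltW xc) andbT|]; exact: xj.
Qed.

Lemma lebesgue_measurable_box a b : lebesgue_measurable (box a b).
Proof.
have lem i (c : R) := lebesgue_measurable_halfspace i c.
have gem i (c : R) : lebesgue_measurable [set x : 'rV[R]_n.+1 | c <= x 0 i].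
  (* The opposite closed half-space is a countable intersection of complements of the measurable
     ones. *)
  rewrite (_ : mkset _ =
      \bigcap_(k : nat) ~` [set x : 'rV[R]_n.+1 | x 0 i <= c - k.+1%:R^-1]).
    by apply: bigcapT_measurable => k; apply: measurableC; exact: lem.
  apply/seteqP; split => x /= cx.
    by move=> k _ /=; apply/negP; rewrite -ltNge (lt_le_trans _ cx)// ltrBlDr ltrDl.
  apply/ler_addgt0Pr => e e0; rewrite -lerBlDr.
  near \oo => k.
  have /negP := cx k Logic.I; rewrite -ltNge => /ltW; apply: le_trans.
  by rewrite lerB// ltW//; near: k; exact: (near_infty_natSinv_lt (PosNum e0)).
rewrite (_ : box a b = \bigcap_(i in [set: 'I_n.+1])
    ([set x | a 0 i <= x 0 i] `&` [set x | x 0 i <= b 0 i])).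
  apply: fin_bigcap_measurable => [|i _]; first exact: finite_finset.
  by apply: measurableI; [exact: gem|exact: lem].
by apply/seteqP; split => [x xab i _|x xab i]; [exact/andP/xab|exact/andP/(xab i)].
Unshelve. all: by end_near.
Qed.

(** An open set is the countable union of the boxes with rational corners that it contains. *)
Lemma lebesgue_measurable_open A : open A -> lebesgue_measurable A.
Proof.
move=> oA.
pose B (z : 'rV[rat]_n.+1 * 'rV[rat]_n.+1) : set 'rV[R]_n.+1 :=
  box (map_mx ratr z.1) (map_mx ratr z.2).
rewrite (_ : A = \bigcup_(z in [set z | B z `<=` A]) B z).
  rewrite bigcup_mkcond; apply: countable_bigcupT_measurable => [|z]; first exact: countableP.
  by case: ifPn => _; [exact: lebesgue_measurable_box|exact: measurable0].
apply/seteqP; split => [x Ax|x [z /= zA Bzx]]; last exact: zA.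
have /nbhs_ballP[e /= e0 xeA] := open_nbhs_nbhs (conj oA Ax).
have /choice[l lP] (i : 'I_n.+1) : exists r : rat, x 0 i - e < ratr r < x 0 i.
  have xe : x 0 i - e < x 0 i by rewrite ltrBlDr ltrDl.
  by have [r] := rat_in_itvoo xe; rewrite in_itv/=; exists r.
have /choice[u uP] (i : 'I_n.+1) : exists r : rat, x 0 i < ratr r < x 0 i + e.
  have xe : x 0 i < x 0 i + e by rewrite ltrDl.
  by have [r] := rat_in_itvoo xe; rewrite in_itv/=; exists r.
exists (\row_i l i, \row_i u i) => /=.
  move=> y By; apply: xeA; split=> // i j; rewrite ord1.
  move: (By j) (lP j) (uP j); rewrite /ball/= !mxE => /andP[? ?] /andP[? ?] /andP[? ?].
  by rewrite ltr_norml; lra.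
by move=> i; rewrite !mxE; case/andP: (lP i) (uP i) => _ /ltW-> /andP[/ltW->].
Qed.

End lebesgue_borel.

(** * Compact sets, and functions continuous near them *)

Section lebesgue_compact.
Variables (R : realType) (n : nat).
Implicit Types (K U : set 'rV[R]_n.+1) (f : 'rV[R]_n.+1 -> R).

Lemma compact_lebesgue_measurable K : compact K -> lebesgue_measurable K.
Proof.
move=> /(compact_closed (@norm_hausdorff _ _)) cK.
by rewrite -[K]setCK; apply: measurableC; exact/lebesgue_measurable_open/closed_openC.
Qed.

Lemma lebesgue_compact_lty K : compact K -> (lebesgue K < +oo)%E.
Proof.
move=> /compact_bounded[r [_ Kr]].
have {}Kr x i : K x -> `|x 0 i| <= r + 1.
  move=> Kx; apply: le_trans (Kr (r + 1) _ x Kx); last by rewrite ltrDl.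
  by rewrite [leRHS]mx_normrE; exact: (le_bigmax _ _ (0, i)).
(* A single cube covers [K]; the remaining boxes are points, of volume 0. *)
pose c (k : nat) : 'rV[R]_n.+1 * 'rV[R]_n.+1 :=
  if k is 0%N then (const_mx (- (r + 1)), const_mx (r + 1)) else (0, 0).
apply: (@le_lt_trans _ _ (\sum_(k <oo) (box_volume (c k).1 (c k).2)%:E)%E).
  apply: ereal_inf_lbound; exists c => // x Kx; exists 0%N => //= i.
  by rewrite !mxE -ler_norml; exact: Kr.
rewrite nneseries_recl//; last by move=> k _; rewrite lee_fin box_volume_ge0.
rewrite eseries0 ?adde0 ?ltry// => -[//|k] _ _.
by rewrite /box_volume (bigD1 ord0)//= mxE subrr maxxx mul0r.
Qed.

(** Continuity is known only at points of [U], so preimages of open intervals become open after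
    intersection with [U], which does not change their trace on [K]. *)
Lemma lebesgue_measurable_fun_in K U f : lebesgue_measurable K -> open U ->
  K `<=` U -> (forall x, U x -> {for x, continuous f}) ->
  measurable_fun (K : set (lebesgue_space R n)) f.
Proof.
move=> mK oU KU cf.
apply: (measurability _ (RGenOpens.measurableE R)) => _ [_ [a [b ->] <-]].
rewrite (_ : K `&` _ = K `&` (U `&` f @^-1` `]a, b[)); last first.
  by apply/seteqP; split=> x /= [Kx]; [split=> //; split=> //; exact: KU|case=> _; split].
apply: measurableI => //; apply: lebesgue_measurable_open.
rewrite openE => x [Ux fx]; apply: filterI; first exact: open_nbhs_nbhs.
by apply: (cf x Ux); apply: open_nbhs_nbhs; split=> //; exact: interval_open.
Qed.

End lebesgue_compact.

(** * Integrals of powers and distribution functions *)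

Section distribution_bound.
Context d (T : measurableType d) (R : realType).
Variables (mu : {measure set T -> \bar R}) (D : set T) (g : T -> R).
Hypothesis mD : measurable D.
Hypothesis muD : (mu D < +oo)%E.
Hypothesis mg : measurable_fun D g.

Let mgX (r : R) : measurable_fun D (fun x => (g x `^ r)%:E).
Proof. by apply/measurable_EFinP; exact: (measurableT_comp (measurable_powR r)). Qed.

Lemma integral_powR_le (M r : R) : 0 <= r ->
  (forall x, D x -> 0 <= g x <= M) ->
  (\int[mu]_(x in D) (g x `^ r)%:E <= (M `^ r)%:E * mu D)%E.
Proof.
move=> r0 gM; rewrite -integral_cst//; apply: ge0_le_integral => // [x _|x].
  by rewrite lee_fin powR_ge0.
move=> /gM /andP[g0 gxM] /=; rewrite lee_fin.
by apply: ge0_ler_powR; rewrite ?nnegrE// (le_trans g0).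
Qed.

(** Pointwise, g^p = g^(p-q) g^q is at most M^(p-q) g^q. *)
Lemma integral_powR_interpolation (M p q : R) : 0 < q <= p ->
  (forall x, D x -> 0 <= g x <= M) ->
  (\int[mu]_(x in D) (g x `^ p)%:E <=
   (M `^ (p - q))%:E * \int[mu]_(x in D) (g x `^ q)%:E)%E.
Proof.
move=> /andP[q0 qp] gM.
have gq0 (r : R) x : D x -> (0 <= (g x `^ r)%:E)%E by rewrite lee_fin powR_ge0.
rewrite -ge0_integralZl_EFin ?powR_ge0//; last exact: gq0.
apply: ge0_le_integral => //; [exact: gq0|exact: measurable_funeM|].
move=> x /gM /andP[g0 gxM]; rewrite -EFinM lee_fin.
have [->|gx0] := eqVneq (g x) 0.
  by rewrite powR0 ?mulr_ge0 ?powR_ge0// gt_eqF// (lt_le_trans q0).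
have -> : g x `^ p = g x `^ (p - q) * g x `^ q.
  by rewrite -powRD ?subrK// gx0 implybT.
rewrite ler_wpM2r ?powR_ge0//.
by rewrite ge0_ler_powR ?subr_ge0 ?nnegrE// (le_trans g0).
Qed.

(** The sublevel sets of [g] are no larger than those of lam u^r for [u] uniform on [0, 1], and the
    mean of (lam u^r)^q is lam^q / (q r + 1). *)
Lemma integral_powR_ge (lam r q : R) : 0 < lam -> 0 < r -> 0 < q ->
  (forall x, D x -> 0 <= g x) ->
  (forall u, 0 < u <= 1 ->
     (mu (D `&` [set x | (g x < lam * u `^ r)%R]) <= u%:E * mu D)%E) ->
  ((lam `^ q / (q * r + 1))%:E * mu D <= \int[mu]_(x in D) (g x `^ q)%:E)%E.
Proof.
move=> lam0 r0 q0 g0 Hu; pose s := q * r.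
have s0 : 0 < s by rewrite mulr_gt0.
have muDfin : mu D \is a fin_num by rewrite ge0_fin_numE.
pose V := fine (mu D); have VE : mu D = V%:E by rewrite fineK.
have V0 : 0 <= V by rewrite fine_ge0.
have L0 : 0 <= lam `^ q by exact: powR_ge0.
(* [g^q] dominates its layer-cake step function with levels [lam (i / k)^r],
   whose integral is at least the claimed bound up to [O(1 / k)]. *)
suff key (k : nat) : (0 < k)%N ->
    ((lam `^ q * ((s + 1)^-1 - k%:R^-1) * V)%:E <= \int[mu]_(x in D) (g x `^ q)%:E)%E.
  apply/lee_addgt0Pr => e e0.
  have [k k0] : exists2 k, (0 < k)%N & lam `^ q * V * k%:R^-1 <= e.
    (* The [+ 1] keeps the denominator positive when [D] is a null set. *)
    have e1 : 0 < e / (lam `^ q * V + 1) by rewrite divr_gt0// ltr_pwDr// mulr_ge0.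
    near \oo => k; exists k.+1 => //.
    have kle : k.+1%:R^-1 <= e / (lam `^ q * V + 1).
      by apply/ltW; near: k; exact: (near_infty_natSinv_lt (PosNum e1)).
    apply: (@le_trans _ _ (lam `^ q * V * (e / (lam `^ q * V + 1)))).
      by rewrite ler_wpM2l// mulr_ge0.
    rewrite mulrA ler_pdivrMr; last by rewrite ltr_pwDr// mulr_ge0.
    by rewrite mulrC ler_wpM2l ?lerDl// ltW.
  move=> ke; apply: le_trans (leeD2r _ (key _ k0)).
  by rewrite VE -EFinM -EFinD lee_fin; move: ke; rewrite -/s; lra.
move=> k0; have kR0 : 0 < k%:R :> R by rewrite ltr0n.
pose x i : R := i%:R / k%:R; pose phi i := x i `^ s.
have x0 i : 0 <= x i by rewrite divr_ge0.
have phiS i : phi i <= phi i.+1.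
  rewrite ge0_ler_powR ?nnegrE ?(ltW s0)//.
  by rewrite ler_pM2r ?invr_gt0// ler_nat.
pose S i := D `&` [set y | lam * x i.+1 `^ r <= g y].
have mS i : measurable (S i).
  have := @measurable_fun_ler _ _ _ D (cst (lam * x i.+1 `^ r)) g.
  by move=> /(_ (measurable_cst _) mg mD [set true] I); rewrite /preimage.
pose c i : R := lam `^ q * (phi i.+1 - phi i).
have c0 i : 0 <= c i by rewrite mulr_ge0// subr_ge0.
pose h (i : nat) y : \bar R := (c i * \1_(S i) y)%:E.
have mh i : measurable_fun D (h i).
  by apply/measurable_EFinP; apply: measurable_funM => //; exact: measurable_indic.
have h0 i y : D y -> (0 <= h i y)%E by move=> _; rewrite lee_fin mulr_ge0.
apply: (@le_trans _ _ (\int[mu]_(y in D) \sum_(i <- index_iota 0 k) h i y)%E); last first.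
  apply: ge0_le_integral => //.
  - by move=> y Dy; apply: sume_ge0 => i _; exact: h0.
  - exact: emeasurable_sum.
  move=> y Dy; rewrite /h sumEFin lee_fin.
  (* The bound by the telescoped heights is carried through the induction: when [y] lies in [S j],
     the new total is at most the q-th power of the level lam x_(j+1)^r, hence at most that of
     [g y]. *)
  have H j : \sum_(0 <= i < j) c i * \1_(S i) y <=
      Num.min (lam `^ q * phi j) (g y `^ q).
    elim: j => [|j IH]; first by rewrite big_geq// le_min powR_ge0 mulr_ge0// powR_ge0.
    rewrite big_nat_recr//= indicE; move: IH; rewrite !le_min => /andP[IH1 IH2].
    case: (boolP (y \in S j)) => [|_].
      rewrite inE => -[_ /= ljg]; rewrite mulr1.
      have up : \sum_(0 <= i < j) c i * \1_(S i) y + c j <= lam `^ q * phi j.+1.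
        by rewrite /c mulrBr; lra.
      rewrite up (le_trans up)//.
      have -> : lam `^ q * phi j.+1 = (lam * x j.+1 `^ r) `^ q.
        by rewrite powRM ?powR_ge0 ?(ltW lam0)// -powRrM [r * q]mulrC.
      rewrite ge0_ler_powR// ?nnegrE//; [exact: ltW| |exact: g0].
      by rewrite mulr_ge0 ?powR_ge0// ltW.
    by rewrite mulr0 addr0 IH2 (le_trans IH1)// ler_wpM2l.
  by have := H k; rewrite le_min => /andP[].
rewrite ge0_integral_sum//.
(* By hypothesis at u = [x i.+1], the superlevel set [S i] has measure at least (1 - [x i.+1]) [V];
   what remains is the Riemann sum estimate. *)
apply: (@le_trans _ _ (\sum_(0 <= i < k) (c i * ((1 - x i.+1) * V))%:E)%E).
  rewrite sumEFin lee_fin.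
  rewrite (eq_bigr (fun i => lam `^ q * V * ((phi i.+1 - phi i) * (1 - x i.+1)))); last first.
    by move=> i _; rewrite /c; ring.
  by rewrite -mulr_sumr mulrAC ler_wpM2l ?mulr_ge0//; exact: powR_abel_sum_ge.
rewrite big_nat [leRHS]big_nat; apply: lee_sum => i /andP[_ ik].
rewrite /h (integralZl_indic _ (fun=> S i))//; last by move/lt_geF; rewrite c0.
rewrite integral_indic// EFinM lee_wpmul2l ?lee_fin//.
have xi : 0 < x i.+1 <= 1 by rewrite divr_gt0//= ?ltr0n// ler_pdivrMr// mul1r ler_nat.
rewrite (_ : S i `&` D = D `\` (D `&` [set y | g y < lam * x i.+1 `^ r])); last first.
  apply/seteqP; split=> y /=.
    by move=> [[Dy ly] _]; split=> // -[_]; rewrite ltNge ly.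
  move=> [Dy nl]; split=> //; split=> //=; rewrite leNgt; apply/negP => gl.
  by apply: nl.
have mB : measurable (D `&` [set y | g y < lam * x i.+1 `^ r]).
  have := @measurable_fun_ltr _ _ _ D g (cst (lam * x i.+1 `^ r)).
  by move=> /(_ mg (measurable_cst _) mD [set true] I); rewrite /preimage.
rewrite measureD// setIA setIid.
have := Hu _ xi; rewrite VE -EFinM => Hui.
rewrite mulrBl mul1r EFinB; by apply: leeB => //; rewrite -VE.
Unshelve. all: by end_near.
Qed.

End distribution_bound.

(** * Positivity of the degree *)

Lemma degreeN_gt0 (R : realType) (mu : nat -> R) (A a b : R) :
  (forall j, (1 <= j)%N -> 0 < mu j) -> b < A -> admissible_tuple mu A a b ->
  (0 < degreeN mu A a b)%N.
Proof.
move=> mu0 bA [A0 a0 b0 adm]; rewrite /degreeN muln_gt0/= truncn_gt0.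
set J := j0 A b in adm *.
have J1 : (1 <= J)%N.
  have l0 : 0 < ln (A / b) by rewrite ln_gt0// ltr_pdivlMr// mul1r.
  have c0 : (0 < Num.ceil (ln (A / b)))%R by rewrite Num.Theory.ceil_gt0.
  by rewrite /J /j0 absz_gt0 gt_eqF// lt_max c0 orbT.
(* The sum attached to [J] is empty, so [J], which is at least 1, is a candidate in the supremum. *)
have JN : degree_set mu A a b J by rewrite /degree_set/= -/J big_geq// expR_gt0.
(* By admissibility some partial sum exceeds e. As the terms are nonnegative, its index bounds
   [degree_set], so the real supremum is a genuine one. *)
have [m mP] : exists m, expR 1 < \sum_(J.+1 <= j < m) (a * mu j)^-1.
  apply: contrapT => /forallNP H; move: adm; apply/negP; rewrite -leNgt.
  apply: lime_le.
    by apply: is_cvg_nneseries => j Jj _; rewrite lee_fin invr_ge0 ltW// mu0// (leq_trans _ Jj).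
  apply: nearW => m /=; rewrite sumEFin lee_fin.
  have /negP := H m; rewrite -leNgt -(ler_pM2l a0); apply: le_trans.
  rewrite mulr_sumr; apply: ler_sum => j _.
  by rewrite invfM mulrA mulfV ?mul1r ?gt_eqF.
apply: (@le_trans _ _ (J%:R : R)); first by rewrite ler1n.
apply: ub_le_sup; last by exists J.
exists m%:R => _ [k + <-] /=; rewrite ler_nat => kd.
rewrite leqNgt; apply/negP => mk.
move: (lt_trans kd mP); rewrite ltNge => /negP; apply.
have pos l j : (J.+1 <= l <= j)%N -> 0 <= (a * mu j)^-1.
  by move=> /andP[Jl lj]; rewrite invr_ge0 mulr_ge0 ?ltW// mu0// (leq_trans _ (leq_trans Jl lj)).
have [Jm|mJ] := leqP J.+1 m; last first.
  rewrite big_geq ?(ltnW mJ)// big_nat; apply: sumr_ge0 => j /andP[Jj _].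
  by rewrite (pos J.+1)// leqnn.
rewrite (@big_cat_nat _ _ _ m _ k.+1)//=; last by rewrite ltnW// ltnW.
by rewrite lerDl big_nat; apply: sumr_ge0 => j /andP[mj _]; rewrite (pos m)// Jm.
Qed.

(** * From a Remez inequality to moment estimates *)

Section remez_moments.
Variables (R : realType) (n : nat) (K : set 'rV[R]_n.+1) (f : 'rV[R]_n.+1 -> R).
Variables (M C nu : R) (N : nat).
Hypothesis compactK : compact K.
Hypothesis mf : measurable_fun (K : set (lebesgue_space R n)) f.
Hypothesis fM : forall x, K x -> `|f x| <= M.
Hypotheses (M0 : 0 < M) (C0 : 0 < C) (nu0 : 0 < nu) (N0 : (0 < N)%N).
(** Any bound [lam] of |f| on [A] stands in for the supremum norm, so that sublevel sets can be
    inserted directly. *)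
Hypothesis remez : forall A (lam : R), lebesgue_measurable A -> A `<=` K ->
  (0 < lebesgue A)%E -> (forall x, A x -> `|f x| <= lam) ->
  M <= C * (volume K / (nu * volume A)) ^+ N * lam.

Lemma lebesgue_volume (A : set 'rV[R]_n.+1) :
  lebesgue_measurable A -> A `<=` K -> lebesgue A = (volume A)%:E.
Proof.
move=> mA AK; rewrite /volume fineK// ge0_fin_numE ?lebesgue_outer_ge0//.
by apply: le_lt_trans (lebesgue_compact_lty compactK); exact: le_lebesgue_outer.
Qed.

Lemma volume_gt0 (A : set 'rV[R]_n.+1) :
  lebesgue_measurable A -> A `<=` K -> (0 < lebesgue A)%E -> 0 < volume A.
Proof. by move=> mA AK; rewrite lebesgue_volume// lte_fin. Qed.

Lemma measurable_fun_sub (A : set 'rV[R]_n.+1) : A `<=` K ->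
  measurable_fun (A : set (lebesgue_space R n)) f.
Proof.
move=> AK; apply: (@measurable_funS _ _ (lebesgue_space R n) _ K) => //.
exact: compact_lebesgue_measurable.
Qed.

(** The mean of |f|^r over [A] as a real number; [fine] loses nothing for measurable [A] of positive
    measure in [K], where |f| is at most [M]. *)
Definition moment (A : set 'rV[R]_n.+1) (r : R) : R :=
  (volume A)^-1 * fine (\int[lebesgue (R:=R) (n:=n)]_(x in A) (`|f x| `^ r)%:E).

Lemma moment_integral (A : set 'rV[R]_n.+1) (r : R) : lebesgue_measurable A ->
  A `<=` K -> (0 < lebesgue A)%E -> 0 <= r ->
  (\int[lebesgue (R:=R) (n:=n)]_(x in A) (`|f x| `^ r)%:E)%E =
    (volume A * moment A r)%:E.
Proof.
move=> mA AK A0 r0; have vA := volume_gt0 mA AK A0.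
rewrite /moment mulrA mulfV ?gt_eqF// mul1r fineK// ge0_fin_numE; last first.
  by apply: integral_ge0 => x _; rewrite lee_fin powR_ge0.
apply: le_lt_trans (integral_powR_le (lebesgue (R:=R) (n:=n)) (M := M) mA _ r0 _) _.
- by apply: measurableT_comp => //; exact: measurable_fun_sub.
- by move=> x /AK Kx; rewrite normr_ge0 fM.
- by rewrite [X in (_ * X)%E](lebesgue_volume mA AK) -EFinM ltry.
Qed.

Lemma moment_ge0 A r : 0 <= moment A r.
Proof.
rewrite /moment mulr_ge0// ?invr_ge0 fine_ge0// ?lebesgue_outer_ge0//.
by apply: integral_ge0 => x _; rewrite lee_fin powR_ge0.
Qed.

Lemma moment_le A r : lebesgue_measurable A -> A `<=` K ->
  (0 < lebesgue A)%E -> 0 <= r -> moment A r <= M `^ r.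
Proof.
move=> mA AK A0 r0; rewrite -(ler_pM2l (volume_gt0 mA AK A0)) -lee_fin.
rewrite -moment_integral// mulrC EFinM -lebesgue_volume//.
apply: (integral_powR_le (lebesgue (R:=R) (n:=n)) mA _ r0).
  by apply: measurableT_comp => //; exact: measurable_fun_sub.
by move=> x /AK Kx; rewrite normr_ge0 fM.
Qed.

Lemma normalized_normE A r : lebesgue_measurable A -> A `<=` K ->
  (0 < lebesgue A)%E -> 0 <= r ->
  normalized_norm r%:E A f = (moment A r `^ r^-1)%:E.
Proof.
move=> mA AK A0 r0; rewrite /normalized_norm moment_integral// -EFinM poweR_EFin.
by rewrite mulrA mulVf ?mul1r// gt_eqF// volume_gt0.
Qed.

Lemma moment_interpolation A q p : lebesgue_measurable A -> A `<=` K ->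
  (0 < lebesgue A)%E -> 0 < q <= p -> moment A p <= M `^ (p - q) * moment A q.
Proof.
move=> mA AK A0 /andP[q0 qp]; have p0 := le_trans (ltW q0) qp.
have vA := volume_gt0 mA AK A0.
rewrite -(ler_pM2l vA) [leRHS]mulrCA -lee_fin [in leRHS]EFinM -!moment_integral// ?(ltW q0)//.
have mfA : measurable_fun (A : set (lebesgue_space R n)) (fun x => `|f x|).
  by apply: measurableT_comp => //; exact: measurable_fun_sub.
have fA x : A x -> 0 <= `|f x| <= M by move=> /AK Kx; rewrite normr_ge0 fM.
have qp' : 0 < q <= p by rewrite q0.
have := @integral_powR_interpolation _ _ _ (lebesgue (R:=R) (n:=n)) A _ mA mfA _ _ _ qp' fA.
done.
Qed.

Lemma moment_remez A q : lebesgue_measurable A -> A `<=` K ->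
  (0 < lebesgue A)%E -> 0 < q ->
  M <= C * (volume K / (nu * volume A)) ^+ N * (q * N%:R + 1) `^ q^-1 *
       moment A q `^ q^-1.
Proof.
move=> mA AK A0 q0; have vA := volume_gt0 mA AK A0.
have mK := compact_lebesgue_measurable compactK.
have vK : 0 < volume K.
  by apply: volume_gt0 => //; apply: lt_le_trans A0 _; exact: le_lebesgue_outer.
set B := C * _; have B0 : 0 < B by rewrite mulr_gt0// exprn_gt0// divr_gt0// mulr_gt0.
have lam0 : 0 < M / B by rewrite divr_gt0.
have rN : 0 < N%:R :> R by rewrite ltr0n.
have Q0 : 0 < q * N%:R + 1 by rewrite ltr_pwDr// mulr_ge0// ltW.
(* Taking q-th roots and solving for [M] gives the claim. *)
suff : (M / B) `^ q / (q * N%:R + 1) <= moment A q.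
  rewrite ler_pdivrMr// => H.
  have : ((M / B) `^ q) `^ q^-1 <= (moment A q * (q * N%:R + 1)) `^ q^-1.
    by rewrite ge0_ler_powR ?nnegrE ?powR_ge0 ?invr_ge0 ?(ltW q0)// mulr_ge0 ?moment_ge0 ?ltW.
  rewrite -powRrM mulfV ?gt_eqF// powRr1 ?(ltW lam0)// ler_pdivrMr//.
  by rewrite powRM ?moment_ge0 ?(ltW Q0)//; lra.
have mfA : measurable_fun (A : set (lebesgue_space R n)) (fun x => `|f x|).
  by apply: measurableT_comp => //; exact: measurable_fun_sub.
have muA : (lebesgue A < +oo)%E by rewrite lebesgue_volume// ltry.
(* If the sublevel set [A'] had measure above u |A|, Remez on [A'] would give M <= M (u |A| /
   |A'|)^N, which is less than [M] because [N] is positive. *)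
have sublevel u : 0 < u <= 1 ->
    (lebesgue (A `&` [set x | (`|f x| < M / B * u `^ N%:R)%R]) <= u%:E * lebesgue A)%E.
  move=> /andP[u0 u1]; rewrite leNgt; apply/negP.
  set A' := A `&` _ => big.
  have A'A : A' `<=` A by move=> x [].
  have A'K : A' `<=` K by exact: subset_trans AK.
  have mA' : lebesgue_measurable A'.
    have := @measurable_fun_ltr _ _ _ (A : set (lebesgue_space R n)) (fun x => `|f x|)
      (cst (M / B * u `^ N%:R)).
    by move=> /(_ mfA (measurable_cst _) mA [set true] I); rewrite /preimage.
  have A'0 : (0 < lebesgue A')%E.
    by apply: le_lt_trans big; rewrite mule_ge0// ?lebesgue_outer_ge0// lee_fin ltW.
  have vA' := volume_gt0 mA' A'K A'0.
  move: big; rewrite (lebesgue_volume mA AK) (lebesgue_volume mA' A'K) -EFinM lte_fin => big.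
  have A'lam x : A' x -> `|f x| <= M / B * u `^ N%:R by case=> _ /ltW.
  have := remez mA' A'K A'0 A'lam.
  rewrite powR_mulrn ?(ltW u0)// leNgt => /negP; apply.
  rewrite [ltLHS](_ : _ = M * (u * volume A / volume A') ^+ N).
    rewrite gtr_pMr// exprn_ilt1// -?lt0n//.
      by rewrite divr_ge0 ?mulr_ge0 ?ltW.
    by rewrite ltr_pdivrMr// mul1r.
  rewrite /B !exprMn !exprVn !exprMn; field.
  by rewrite !expf_neq0 ?gt_eqF.
have f0 x : A x -> 0 <= `|f x| by [].
have := @integral_powR_ge _ _ _ (lebesgue (R:=R) (n:=n)) A _ mA muA mfA _ _ _
  lam0 rN q0 f0 sublevel.
rewrite [X in (_ * X <= _)%E](lebesgue_volume mA AK).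
rewrite [X in (_ <= X)%E](moment_integral mA AK A0 (ltW q0)).
by rewrite -EFinM lee_fin [leRHS]mulrC ler_pM2r.
Qed.

Lemma normalized_norm_interpolation q (p : \bar R) : (0 < lebesgue K)%E ->
  0 < q -> (q%:E < p)%E ->
  (normalized_norm p K f <= (M `^ (1 - q * inv_exponent p) *
    (moment K q `^ q^-1) `^ (q * inv_exponent p))%:E)%E.
Proof.
move=> K0 q0; have mK := compact_lebesgue_measurable compactK.
case: p => [p|_|//]; first (rewrite lte_fin => qp).
  have p0 := lt_trans q0 qp.
  rewrite normalized_normE// ?(ltW p0)// lee_fin /=.
  rewrite -powRrM mulrA mulVf ?gt_eqF// mul1r.
  have -> : 1 - q / p = (p - q) * p^-1 by rewrite mulrBl mulfV ?gt_eqF.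
  rewrite powRrM -powRM ?powR_ge0 ?moment_ge0//.
  apply: ge0_ler_powR; rewrite ?nnegrE ?invr_ge0 ?(ltW p0) ?moment_ge0//.
    by rewrite mulr_ge0 ?powR_ge0 ?moment_ge0.
  by apply: moment_interpolation => //; rewrite q0 ltW.
(* For p = +oo the right-hand side reduces to [M], a bound for |f| everywhere on [K]. *)
rewrite /= mulr0 subr0 powRr0 mulr1 powRr1 ?(ltW M0)//.
by apply: ereal_inf_lbound; apply: aeW => x Kx; rewrite lee_fin fM.
Qed.

End remez_moments.

(** * The Remez factor and the three norm estimates *)

Lemma remez_factor_le (R : realType) (nu k e : R) : 0 < nu <= 1 -> 0 < e <= k ->
  0 < k `^ nu / (k `^ nu - (k - e) `^ nu) <= k / (nu * e).
Proof.
move=> /andP[nu0 nu1] /andP[e0 ek]; have k0 := lt_le_trans e0 ek.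
have knu := powR_gt0 nu k0.
have t01 : 0 <= e / k <= 1 by rewrite divr_ge0 ?(ltW e0) ?(ltW k0)//= ler_pdivrMr// mul1r.
(* With t = e/k, the bound (1 - t)^nu <= 1 - nu t makes the denominator at least k^nu nu t. *)
have H : (k - e) `^ nu <= k `^ nu * (1 - nu * (e / k)).
  have -> : k - e = k * (1 - e / k) by field; rewrite gt_eqF.
  have t1 : 0 <= 1 - e / k by rewrite subr_ge0; case/andP: t01.
  rewrite powRM// ?(ltW k0)// ler_wpM2l ?powR_ge0//.
  by apply: powR_compl_le => //; rewrite nu0.
have d0 : 0 < k `^ nu * (nu * (e / k)) by rewrite !mulr_gt0 ?invr_gt0.
have dle : k `^ nu * (nu * (e / k)) <= k `^ nu - (k - e) `^ nu.
  by move: H; rewrite mulrBr mulr1; lra.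
have D0 := lt_le_trans d0 dle.
rewrite divr_gt0//= ler_pdivrMr//.
rewrite [leLHS](_ : _ = k / (nu * e) * (k `^ nu * (nu * (e / k)))); last first.
  by field; rewrite !gt_eqF.
by rewrite ler_wpM2l// divr_ge0 ?ltW// mulr_gt0.
Qed.

Lemma sup_norm_scalar_map (R : realType) (n : nat) (A : set 'rV[R]_n.+1)
    (f : 'rV[R]_n.+1 -> R) :
  sup_norm A (scalar_map f) = sup [set `|f x| | x in A].
Proof.
rewrite /sup_norm; congr sup; apply/eq_imagel => x _.
by rewrite big_ord_recl big_ord0 addr0 mxE.
Qed.

Lemma constC_gt0 (R : realType) (h : R -> R) N : 0 < constC h N.
Proof. by rewrite exprn_gt0// mulr_gt0 ?expR_gt0. Qed.

Theorem theorem7p4 (R : realType) (n : nat)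
    (mut : (nat -> R) -> R -> R)
    (hmut : forall w : nat -> R,
       admissible_weight w -> weight_interpolation w (mut w))
    (L K : set 'rV[R]_n.+1) (d : nat) (nu : R)
    (hL : convex_body L) (hK : fixed_degree d K) (hKL : K `<=` L)
    (hnu : remez_constant mut d K nu)
    (mu : nat -> R) (hmu : admissible_weight mu)
    (hmuj : forall j : nat, (1 <= j)%N -> j%:R <= mu j)
    (M0 b0 : R) (hb0 : 0 < b0) (hM0 : b0 < M0)
    (hadm : admissible_tuple mu M0 (a_const d K) b0)
    (N : nat) (hN : N = degreeN mu M0 (a_const d K) b0)
    (f : 'rV[R]_n.+1 -> R) (hf : smooth mu N M0 L (scalar_map f))
    (hfK : b0 <= sup_norm K (scalar_map f))
    (E : set 'rV[R]_n.+1) (hE : lebesgue_measurable E) (hEK : E `<=` K)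
    (hE0 : (0 < lebesgue E)%E)
    (q : R) (p : \bar R) (hq : 0 < q) (hqp : (q%:E < p)%E) :
  let C := constC (mut mu) N in
  let qp := q * inv_exponent p in
  [/\ (normalized_norm p K f <=
        ((C * (volume K / (nu * volume E)) ^+ N) `^ (1 - qp) *
         (q * N%:R + 1) `^ (q^-1 - inv_exponent p))%:E *
        normalized_norm q%:E K f `^ qp *
        normalized_norm q%:E E f `^ (1 - qp))%E,
      (normalized_norm p K f <=
        ((C / nu ^+ N) `^ (1 - qp) *
         (q * N%:R + 1) `^ (q^-1 - inv_exponent p))%:E *
        normalized_norm q%:E K f)%E &
      (normalized_norm p K f <=
        (C * (volume K / (nu * volume E)) ^+ N *
         (q * N%:R + 1) `^ q^-1)%:E *
        normalized_norm q%:E E f)%E].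
Proof.
move=> C qp.
have [[_ cK _] _] := hK.
have [/andP[nu0 nu1] _ Remez] := hnu.
pose M := sup_norm K (scalar_map f).
have M_gt0 : 0 < M := lt_le_trans hb0 hfK.
have fM x : K x -> `|f x| <= M.
  (* [f] is bounded on [K] since the supremum of an unbounded set would be [0]. *)
  move=> Kx; rewrite /M sup_norm_scalar_map; apply: ub_le_sup; last by exists x.
  apply: contrapT => nub; move: M_gt0; rewrite /M sup_norm_scalar_map sup_out ?ltxx//.
  by case.
have C0 : 0 < C := constC_gt0 _ _.
have N0 : (0 < N)%N.
  by rewrite hN degreeN_gt0// => j j1; apply: lt_le_trans (hmuj j j1); rewrite ltr0n.
have mK := compact_lebesgue_measurable cK.
have K0 : (0 < lebesgue K)%E by apply: lt_le_trans hE0 _; exact: le_lebesgue_outer.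
have mf : measurable_fun (K : set (lebesgue_space R n)) f.
  have [[U [oU LU cU]] _] := hf.
  apply: (lebesgue_measurable_fun_in mK oU (subset_trans hKL LU)) => x Ux.
  (* The empty list of derivatives in [class_C] gives continuity of [f] itself. *)
  have [/(_ [::] x isT Ux) + _] := cU 0.
  rewrite /iter_partial/= (_ : (fun x => scalar_map f x 0 0) = f)//.
  by apply/funext => y; rewrite mxE.
have vol A : lebesgue_measurable A -> A `<=` K -> (0 < lebesgue A)%E -> 0 < volume A <= volume K.
  move=> mA AK A0; rewrite (volume_gt0 cK mA AK A0)/= -lee_fin.
  by rewrite -!(lebesgue_volume cK)//; exact: le_lebesgue_outer.
(* The assumed inequality with m = 1, its factor simplified by [remez_factor_le] and its supremum
   norm replaced by [lam]. *)
have remez A (lam : R) : lebesgue_measurable A -> A `<=` K -> (0 < lebesgue A)%E ->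
    (forall x, A x -> `|f x| <= lam) -> M <= C * (volume K / (nu * volume A)) ^+ N * lam.
  move=> mA AK A0 Alam; have /andP[vA vAK] := vol A mA AK A0.
  have := Remez L mu M0 b0 1%N (scalar_map f) A hL hKL hmu hmuj hb0 hM0 isT.
  rewrite mul1r => /(_ hadm)/=; rewrite -hN => /(_ hf hfK mA AK A0); rewrite mul1r.
  have Ane : A !=set0.
    by apply/set0P/eqP => A_0; move: A0; rewrite A_0 [lebesgue _]lebesgue_outer0 ltxx.
  have lamA : sup_norm A (scalar_map f) <= lam.
    rewrite sup_norm_scalar_map; apply: ge_sup; first by case: Ane => a Aa; exists `|f a|, a.
    by move=> _ [x Ax <-]; exact: Alam.
  have lam0 : 0 <= lam by case: Ane => a /Alam; exact: le_trans.
  have nu01 : 0 < nu <= 1 by rewrite nu0.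
  have /andP[F0 Fle] := remez_factor_le nu01 (vol A mA AK A0).
  set F := _ / _ in F0 Fle *; move/le_trans; apply.
  apply: (@le_trans _ _ (C * F ^+ N * lam)).
    by rewrite ler_wpM2l// mulr_ge0 ?(ltW C0)// exprn_ge0 ?(ltW F0).
  by rewrite ler_wpM2r// ler_pM2l// lerXn2r// ?nnegrE ltW// (lt_le_trans F0).
have M_le A := @moment_remez _ _ _ _ M C nu N cK mf fM M_gt0 C0 nu0 N0 remez A q.
have norm_le := normalized_norm_interpolation cK mf fM M_gt0 K0 hq hqp.
have normE A mA AK A0 := @normalized_normE _ _ _ _ M cK mf fM A q mA AK A0 (ltW hq).
rewrite (normE K mK (fun=> id) K0) (normE E hE hEK hE0).
rewrite !poweR_EFin -!EFinM.
(* [a] and [b] are the normalized L^q norms on [K] and on [E]. *)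
set a := moment f K q `^ q^-1 in norm_le *; set b := moment f E q `^ q^-1.
have a0 : 0 <= a by exact: powR_ge0.
have b0' : 0 <= b by exact: powR_ge0.
set B := C * _; set Q := q * N%:R + 1.
have ME : M <= B * Q `^ q^-1 * b := M_le E hE hEK hE0 hq.
(* For the set [K] itself the volumes cancel and leave 1/nu. *)
have MK : M <= C * nu^-1 ^+ N * Q `^ q^-1 * a.
  have vK : volume K != 0 by rewrite gt_eqF// (volume_gt0 cK).
  have <- : volume K / (nu * volume K) = nu^-1 by rewrite invfM mulrCA mulfV// mulr1.
  exact: M_le K mK (fun=> id) K0 hq.
rewrite -/qp in norm_le.
have qp0 : 0 <= qp.
  rewrite /qp mulr_ge0 ?(ltW hq)//; case: (p) hqp => //= r.
  by rewrite lte_fin invr_ge0 => /ltW; apply: le_trans; exact: ltW.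
have qp1 : 0 < 1 - qp.
  rewrite subr_gt0 /qp; case: (p) hqp => [r|_|//]; last by rewrite /= mulr0.
  by rewrite lte_fin /= => qr; rewrite ltr_pdivrMr ?mul1r// (lt_trans hq).
have Q0 : 0 <= Q by rewrite addr_ge0// mulr_ge0// ltW.
(* Raising the bound on [M] to the power 1 - q/p turns the exponent 1/q into (1/q)(1 - q/p) = 1/q -
   1/p. *)
have split c e : 0 <= c -> 0 <= e -> M <= c * Q `^ q^-1 * e ->
    M `^ (1 - qp) <= c `^ (1 - qp) * Q `^ (q^-1 - inv_exponent p) * e `^ (1 - qp).
  move=> c0 e0 Mle.
  have -> : q^-1 - inv_exponent p = q^-1 * (1 - qp).
    by rewrite mulrBr mulr1 /qp mulrA mulVf ?mul1r// gt_eqF.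
  rewrite powRrM -!powRM ?mulr_ge0 ?powR_ge0//.
  by apply: ge0_ler_powR => //; rewrite ?nnegrE ?mulr_ge0 ?powR_ge0// ltW.
have B0 : 0 <= B.
  have /andP[vE vEK] := vol E hE hEK hE0.
  rewrite /B mulr_ge0 ?(ltW C0)// exprn_ge0// divr_ge0//; first exact: le_trans (ltW vE) vEK.
  by rewrite mulr_ge0 ?(ltW nu0) ?(ltW vE).
have Cnu0 : 0 <= C * nu^-1 ^+ N by rewrite mulr_ge0 ?exprn_ge0 ?invr_ge0 ?(ltW C0) ?(ltW nu0).
have aM : a <= M.
  have Mq := moment_le cK mf fM mK (fun=> id) K0 (ltW hq).
  have -> : M = (M `^ q) `^ q^-1 by rewrite -powRrM mulfV ?gt_eqF// powRr1 ?ltW.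
  by apply: ge0_ler_powR; rewrite ?nnegrE ?invr_ge0 ?powR_ge0 ?moment_ge0 ?(ltW hq).
clearbody a b B.
split; apply: le_trans norm_le _; rewrite lee_fin.
- by rewrite mulrAC ler_wpM2r ?powR_ge0//; exact: split.
(* Here [M] is bounded through [K], and the two powers of [a] combine to [a]. *)
- rewrite -exprVn; apply: (le_trans (ler_wpM2r (powR_ge0 _ _) (split _ _ Cnu0 a0 MK))).
  rewrite -[leLHS]mulrA -powRD; last by rewrite subrK oner_eq0.
  by rewrite subrK powRr1.
(* Since [a] is at most [M], the interpolated bound is at most [M], which [ME] controls by the norm
   on [E]. *)
apply: le_trans ME.
apply: (@le_trans _ _ (M `^ (1 - qp) * M `^ qp)).
  by rewrite ler_wpM2l ?powR_ge0// ge0_ler_powR// nnegrE ltW.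
by rewrite -powRD ?subrK ?powRr1 ?(ltW M_gt0)// (gt_eqF M_gt0) implybT.
Qed.
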